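(* Let $B,\bar B$ be real or complex vector spaces, $L(\varepsilon)=\sum_{i=0}^\infty\varepsilon^iL_i$ a formal power series with $L_i\in L(B,\bar B)$, $L(\varepsilon)\not\equiv0$. Let $k\ge0$ and let the recursion of the context be performed (with some choice of complements) up to and including stage $k+1$, with associated direct sums $$B=N_0^c\oplus N_1^c\oplus\cdots\oplus N_{k+1}^c\oplus N_{k+1},\qquad \bar B=R_0\oplus R_1\oplus\cdots\oplus R_{k+1}\oplus R_{k+1}^c,$$ where $N_i=N_{i+1}^c\oplus\cdots\oplus N_{k+1}^c\oplus N_{k+1}$ and $R_i^c=R_{i+1}\oplus\cdots\oplus R_{k+1}\oplus R_{k+1}^c$. Then the polynomial $$p_k(\varepsilon)=I_B+\varepsilon M_{k,k+1}+\cdots+\varepsilon^kM_{1,k+1}$$ transforms $L(\varepsilon)$ into $$S_k(\varepsilon):=L(\varepsilon)\cdot p_k(\varepsilon)=S_1+\varepsilon S_2+\cdots+\varepsilon^kS_{k+1}+\sum_{i=k+1}^\infty\varepsilon^iQ_{i+1}$$ with some remainder coefficients $Q_{i+1}\in L(B,\bar B)$, and the $k+1$ leading coefficients $S_1,\dots,S_{k+1}\in L(B,\bar B)$ satisfy, for $i=1,\dots,k+1$, $$S_i(N_0^c+\cdots+N_{i-1}^c)\subset R_{i-1}^c,\qquad S_i(N_i^c)=R_i,\qquad S_i(N_i)=\{0\}.$$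
   Context: $L(X,Y)$ denotes the linear maps from $X$ to $Y$; $I_X$ is the identity. Formal power series in $\varepsilon$ are multiplied by the Cauchy product. Recursion. Put $N_0:=B$, $N_0^c:=\{0\}$, $R_0:=\{0\}$, $R_0^c:=\bar B$, $\bar S_1:=S_1:=L_0$, $E_{1,1}:=M_{1,1}:=I_B$. At each stage $j\ge1$, given $S_j\in L(B,R_{j-1}^c)$, set $N_j:=\{n\in N_{j-1}\mid S_jn=0\}$, $R_j:=S_j(N_{j-1})$ and choose algebraic direct complements $N_{j-1}=N_j^c\oplus N_j$, $R_{j-1}^c=R_j\oplus R_j^c$. Then $B=N_1^c\oplus\cdots\oplus N_j^c\oplus N_j$ and $\bar B=R_1\oplus\cdots\oplus R_j\oplus R_j^c$; $\mathcal P_j$ denotes the projection of $\bar B$ onto $R_j$ defined by the latter decomposition, and $S_j^{-1}:R_j\to N_j^c$ denotes the inverse of the bijection $S_j|_{N_j^c}:N_j^c\to R_j$. At stage $j\ge2$, the operators are defined by $$\bar S_j:=\sum_{i=1}^{j-1}L_iM_{i,j-1},\qquad S_j:=(I_{\bar B}-\mathcal P_1-\cdots-\mathcal P_{j-1})\bar S_j,$$ $$E_{j,j}:=I_B,\qquad E_{i,j}:=-S_i^{-1}\mathcal P_i\sum_{\nu=i+1}^{j}\bar S_\nu E_{\nu,j}\quad (i=j-1,\dots,1),$$ $$M_{1,j}:=E_{1,j},\qquad M_{i,j}:=\sum_{\nu=i}^{j}M_{i-1,\nu-1}E_{\nu,j}\quad(i=2,\dots,j).$$ (So $M_{j,j}=I_B$.)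 *)

(* Defs.v *)
From HB Require Import structures.
From mathcomp Require Import all_boot all_order all_algebra.
From mathcomp Require Import all_classical all_reals.
From mathcomp Require Import complex.

Set Implicit Arguments.
Unset Strict Implicit.
Unset Printing Implicit Defensive.

Import Order.TTheory GRing.Theory Num.Theory.
Local Open Scope classical_set_scope.
Local Open Scope ring_scope.

Variant real_or_complex (R : realType) : fieldType -> Prop :=
| RealScalars : real_or_complex R R
| ComplexScalars : real_or_complex R R[i].

Section Subspaces.
Context {K : fieldType} {V : lmodType K}.

Definition subspace (A : set V) : Prop := GRing.submod_closed [in A].

Definition direct_sum (C A1 A2 : set V) : Prop :=
  [/\ subspace A1, subspace A2,
      C = [set a1 + a2 | a1 in A1 & a2 in A2] & A1 `&` A2 = [set 0]].

(* A_m + ... + A_(n-1), equal to {0} when n <= m *)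
Definition subspace_sum (A : nat -> set V) (m n : nat) : set V :=
  [set \sum_(m <= l < n) v l | v in
    [set v : nat -> V | forall l, (m <= l < n)%N -> A l (v l)]].

(* The R_j-component of x with respect to V = R_1 + ... + R_j + Rc_j; it is
   uniquely determined as soon as this sum is direct. *)
Definition proj (R Rc : nat -> set V) (j : nat) (x : V) : V :=
  xget 0 [set y | R j y /\
    exists s c, [/\ subspace_sum R 1 j s, Rc j c & x = s + y + c]].

End Subspaces.

Section Series.
Context {K : fieldType} {U V W : lmodType K}.

(* A formal power series sum_n eps^n F_n is its coefficient sequence F. *)
Definition cauchy_prod (F : nat -> V -> W) (G : nat -> U -> V) : nat -> U -> W :=
  fun n x => \sum_(0 <= i < n.+1) F i (G (n - i)%N x).

End Series.

Section Recursion.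
Context {K : fieldType} {B Bbar : lmodType K}.

(* The recursion for L carried out up to and including stage m. Only the
   values of the families at indices occurring in stages <= m are constrained.
   Linearity of the operators is a consequence and is not assumed. *)
Record recursion (L : nat -> {linear B -> Bbar}) (m : nat)
    (N Nc : nat -> set B) (R Rc : nat -> set Bbar)
    (Sbar S : nat -> B -> Bbar) (E M : nat -> nat -> B -> B) : Prop :=
  Recursion {
    rec_N0 : N 0%N = setT;
    rec_Nc0 : Nc 0%N = [set 0];
    rec_R0 : R 0%N = [set 0];
    rec_Rc0 : Rc 0%N = setT;
    rec_Sbar1 : Sbar 1%N =1 L 0%N;
    rec_S1 : S 1%N =1 L 0%N;
    rec_E11 : E 1%N 1%N =1 id;
    rec_M11 : M 1%N 1%N =1 id;
    rec_N : forall j, (1 <= j <= m)%N ->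
      N j = [set n | N j.-1 n /\ S j n = 0];
    rec_R : forall j, (1 <= j <= m)%N -> R j = S j @` N j.-1;
    rec_Nc : forall j, (1 <= j <= m)%N -> direct_sum (N j.-1) (Nc j) (N j);
    rec_Rc : forall j, (1 <= j <= m)%N -> direct_sum (Rc j.-1) (R j) (Rc j);
    rec_Sbar : forall j, (2 <= j <= m)%N -> forall x,
      Sbar j x = \sum_(1 <= i < j) L i (M i j.-1 x);
    rec_S : forall j, (2 <= j <= m)%N -> forall x,
      S j x = Sbar j x - \sum_(1 <= i < j) proj R Rc i (Sbar j x);
    rec_Ejj : forall j, (2 <= j <= m)%N -> E j j =1 id;
    (* 'pinv_(fun=> 0) (Nc i) (S i) is the inverse of S i : Nc i -> R i,
       with junk value 0 outside of R i. *)
    rec_E : forall j, (2 <= j <= m)%N -> forall i, (1 <= i < j)%N -> forall x,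
      E i j x = - 'pinv_(fun=> 0) (Nc i) (S i)
        (proj R Rc i (\sum_(i.+1 <= nu < j.+1) Sbar nu (E nu j x)));
    rec_M1 : forall j, (2 <= j <= m)%N -> M 1%N j =1 E 1%N j;
    rec_M : forall j, (2 <= j <= m)%N -> forall i, (2 <= i <= j)%N -> forall x,
      M i j x = \sum_(i <= nu < j.+1) M i.-1 nu.-1 (E nu j x)
  }.

(* I_B + eps M_(k,k+1) + ... + eps^k M_(1,k+1) *)
Definition transformation (M : nat -> nat -> B -> B) (k : nat) : nat -> B -> B :=
  fun n => if n == 0%N then id
           else if (n <= k)%N then M (k.+1 - n)%N k.+1
           else fun=> 0.

End Recursion.

(* Main.v *)
Require Import Defs.
From HB Require Import structures.
From mathcomp Require Import all_boot all_order all_algebra.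
From mathcomp Require Import all_classical all_reals.
From mathcomp Require Import complex.
From mathcomp Require Import zify.
Set Implicit Arguments.
Unset Strict Implicit.
Unset Printing Implicit Defensive.
Import Order.TTheory GRing.Theory Num.Theory.
Local Open Scope classical_set_scope.
Local Open Scope ring_scope.

(* With M_(0,0) = I and M_(0,nu) = 0 for nu > 0, the recursion for M reads
   M_(i,j) = sum_nu M_(i-1,nu-1) E_(nu,j) for every i, so the coefficient of eps^(j-1)
   in L * p_(j-1) is sum_nu Sbar_nu E_(nu,j). The E_(i,j) are chosen so that
   S_i E_(i,j) cancels the R_i-components of the terms nu > i, which leaves
   exactly S_j. The lower coefficients do not change when k grows, because
   E_(nu,j) takes its values in N^c_nu, where the earlier S_i vanish. *)

(** * Linear maps given as bare functions *)

Section LinearMaps.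
Context {K : fieldType} {U V : lmodType K}.

(** The recursion provides bare functions; bundling one gives access to the library rules for linear
    maps. *)
Lemma linear_packed (f : U -> V) :
  linear f -> exists g : {linear U -> V}, f = g.
Proof.
move=> lf; pose h := GRing.isLinear.Build K U V *:%R f lf.
pose g : {linear U -> V} := HB.pack f h.
by exists g.
Qed.

Lemma linear_eqfun (f g : U -> V) : f =1 g -> linear g -> linear f.
Proof. by move=> fg lg a x y; rewrite !fg lg. Qed.

Lemma linear_comp (W : lmodType K) (g : V -> W) (f : U -> V) :
  linear g -> linear f -> linear (fun x => g (f x)).
Proof. by move=> lg lf a x y; rewrite lf lg. Qed.

Lemma linear_bigsum (m n : nat) (f : nat -> U -> V) :
  (forall i, (m <= i < n)%N -> linear (f i)) ->
  linear (fun x => \sum_(m <= i < n) f i x).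
Proof.
move=> lf a x y; rewrite scaler_sumr -big_split /=.
by apply: eq_big_nat => i hi; rewrite lf.
Qed.

Lemma linear_sub (f g : U -> V) :
  linear f -> linear g -> linear (fun x => f x - g x).
Proof. by move=> lf lg a x y; rewrite lf lg scalerBr opprD addrACA. Qed.

Lemma linear_oppr (f : U -> V) : linear f -> linear (fun x => - f x).
Proof. by move=> lf a x y; rewrite lf opprD scalerN. Qed.

Lemma linear_at0 (f : U -> V) : linear f -> f 0 = 0.
Proof. by move=> /linear_packed[g ->]; rewrite linear0. Qed.

End LinearMaps.

(** * Subspaces and their finite sums *)

Section Subspace.
Context {K : fieldType} {V : lmodType K}.
Implicit Types A : set V.

Lemma subspace0 A : subspace A -> A 0.
Proof. by case=> /set_mem. Qed.

Lemma subspaceP A (a : K) x y : subspace A -> A x -> A y -> A (a *: x + y).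
Proof. by move=> [_ hA] Ax Ay; apply/set_mem/hA; apply/mem_set. Qed.

Lemma subspaceD A x y : subspace A -> A x -> A y -> A (x + y).
Proof. by move=> sA Ax Ay; rewrite -[x]scale1r; apply: subspaceP. Qed.

Lemma subspaceN A x : subspace A -> A x -> A (- x).
Proof.
move=> sA Ax; rewrite -[- x]addr0 -scaleN1r.
by apply: subspaceP => //; apply: subspace0.
Qed.

Lemma subspace_sum_linear (A : nat -> set V) m n (a : K) s t :
  (forall l, (m <= l < n)%N -> subspace (A l)) ->
  subspace_sum A m n s -> subspace_sum A m n t ->
  subspace_sum A m n (a *: s + t).
Proof.
move=> sA [v hv <-] [w hw <-]; exists (fun l => a *: v l + w l).
  by move=> l hl; apply: subspaceP; [apply: sA|apply: hv|apply: hw].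
by rewrite big_split /= scaler_sumr.
Qed.

End Subspace.

(** Both sides run over the triangle m <= i <= l < n; the dependent ranges become guards on a
    square, where the sums commute. *)
Lemma exchange_big_triangle (V : nmodType) m n (F : nat -> nat -> V) :
  \sum_(m <= i < n) \sum_(i <= l < n) F i l =
  \sum_(m <= l < n) \sum_(m <= i < l.+1) F i l.
Proof.
transitivity (\sum_(m <= i < n) \sum_(m <= l < n | (i <= l)%N) F i l).
  by apply: eq_big_nat => i /andP[mi _]; rewrite (big_nat_widenl _ m).
rewrite (exchange_big_dep_nat xpredT) //=.
apply: eq_big_nat => l /andP[_ ln].
by rewrite [RHS](big_nat_widen _ _ n).
Qed.

(** * Projections for an iterated direct decomposition *)

Section Projections.
Context {K : fieldType} {V : lmodType K} {m : nat} {R Rc : nat -> set V}.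
Hypothesis Rc0 : Rc 0%N = setT.
Hypothesis sumRc :
  forall j, (1 <= j <= m)%N -> direct_sum (Rc j.-1) (R j) (Rc j).

Lemma subspace_R j : (1 <= j <= m)%N -> subspace (R j).
Proof. by move=> /sumRc[]. Qed.

Lemma subspace_Rc j : (j <= m)%N -> subspace (Rc j).
Proof.
case: j => [_|j hj]; last by case: (@sumRc j.+1).
by rewrite Rc0; split=> [|a x y _ _]; apply/mem_set.
Qed.

Lemma subspace_sum_R_linear j (a : K) s t : (j <= m.+1)%N ->
  subspace_sum R 1 j s -> subspace_sum R 1 j t ->
  subspace_sum R 1 j (a *: s + t).
Proof.
move=> jm; apply: subspace_sum_linear => l /andP[l1 lj].
by apply: subspace_R; lia.
Qed.

(** Directness of the whole decomposition from the stagewise splittings: the last summand plus [c]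
    lies in the previous R^c, so it vanishes by induction, and then [c] lies in both R_j and
    R^c_j. *)
Lemma direct_sum_R_Rc j s c : (j <= m)%N ->
  subspace_sum R 1 j.+1 s -> Rc j c -> s + c = 0 -> c = 0.
Proof.
elim: j s c => [|j IH] s c jm [v hv <-].
  by rewrite big_geq // add0r.
rewrite big_nat_recr //= -addrA => cj e.
have [sR sRc def_Rc RRc0] := sumRc (j := j.+1) jm.
have Rv : R j.+1 (v j.+1) by apply: hv; rewrite /= ltnS leqnn.
have vc0 : v j.+1 + c = 0.
  apply: (IH _ _ (ltnW jm) _ _ e).
    exists v => // l /andP[l1 lj]; apply: hv.
    by rewrite l1 (leq_trans lj).
  by rewrite def_Rc; exists (v j.+1) => //; exists c.
have Rcj : R j.+1 c.
  by rewrite -(addr0_eq vc0); apply: subspaceN.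
by have : [set 0] c by rewrite -RRc0.
Qed.

(** Lets [proj], defined by choice, be computed from any decomposition. For two of them, (y' - y) +
    (c' - c) lies in the preceding R^c and is cancelled by a sum over the earlier R_i, hence is
    0. *)
Lemma proj_unique j x s y c : (1 <= j <= m)%N ->
  subspace_sum R 1 j s -> R j y -> Rc j c -> x = s + y + c ->
  Defs.proj R Rc j x = y.
Proof.
case: j => // j /= jm hs hy hc ex.
have [sR sRc def_Rc RRc0] := sumRc (j := j.+1) jm.
apply: xget_unique; first by split=> //; exists s, c.
move=> y' [hy' [s' [c' [hs' hc' ex']]]].
have sub0 : (y' - y) + (c' - c) = 0.
  apply: (@direct_sum_R_Rc j ((-1) *: s + s')).
  - exact: ltnW.
  - by apply: subspace_sum_R_linear => //; apply: ltnW.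
  - rewrite def_Rc; exists (y' - y).
      by apply: subspaceD => //; apply: subspaceN.
    by exists (c' - c) => //; apply: subspaceD => //; apply: subspaceN.
  - have : x - x = 0 by rewrite subrr.
    rewrite {1}ex' ex => <-; rewrite scaleN1r.
    by rewrite !opprD [RHS]addrACA [s' + y' + _]addrACA [- s + s']addrC !addrA.
have : [set 0] (y' - y).
  rewrite -RRc0; split; first by apply: subspaceD => //; apply: subspaceN.
  move/addr0_eq: sub0 => /(congr1 -%R); rewrite opprK => ->.
  by rewrite opprB; apply: subspaceD => //; apply: subspaceN.
by move=> /eqP; rewrite subr_eq0 => /eqP.
Qed.

(** What remains after j projections lies in R^c_j and splits along R_(j+1) and R^c_(j+1); its first
    part is the next projection. The claims are carried together because the earlier components
    witness that decomposition. *)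
Lemma proj_sum_spec j x : (j <= m)%N ->
  (forall i, (1 <= i <= j)%N -> R i (Defs.proj R Rc i x)) /\
  Rc j (x - \sum_(1 <= i < j.+1) Defs.proj R Rc i x).
Proof.
elim: j => [_|j IH jm].
  by split=> [i|]; [case: i|rewrite Rc0].
have [hR hRc] := IH (ltnW jm).
have [sR sRc def_Rc RRc0] := sumRc (j := j.+1) jm.
move: hRc; rewrite def_Rc => -[y hy [c hc e]].
have ex : x = \sum_(1 <= i < j.+1) Defs.proj R Rc i x + y + c.
  by rewrite -addrA e addrC subrK.
have pj : Defs.proj R Rc j.+1 x = y.
  apply: (proj_unique _ _ hy hc ex) => //.
  by exists (fun i => Defs.proj R Rc i x).
split=> [i /andP[i1]|].
  by rewrite leq_eqVlt => /predU1P[->|ij]; [rewrite pj|apply: hR; rewrite i1].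
by rewrite big_nat_recr //= pj {1}ex [_ + y + c]addrC addrK.
Qed.

Lemma proj_range j x : (1 <= j <= m)%N -> R j (Defs.proj R Rc j x).
Proof.
move=> /andP[j1 jm]; have [hR _] := proj_sum_spec x jm.
by apply: hR; rewrite j1 /=.
Qed.

Lemma sub_proj_range j x : (j <= m)%N ->
  Rc j (x - \sum_(1 <= i < j.+1) Defs.proj R Rc i x).
Proof. by move=> /proj_sum_spec -/(_ x)[]. Qed.

(** Combining the decompositions of [x] and [y] gives one of [a *: x + y], and uniqueness reads off
    its component. *)
Lemma proj_linear j : (1 <= j <= m)%N -> linear (Defs.proj R Rc j).
Proof.
case: j => // j jm a x y; pose s z := \sum_(1 <= i < j.+1) Defs.proj R Rc i z.
pose c z := z - \sum_(1 <= i < j.+2) Defs.proj R Rc i z.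
have decomp z : z = s z + Defs.proj R Rc j.+1 z + c z.
  by rewrite /c big_nat_recr //= -/(s z) [RHS]addrC subrK.
have hs z : subspace_sum R 1 j.+1 (s z).
  exists (fun i => Defs.proj R Rc i z) => // i /andP[i1 ij].
  by apply: proj_range; lia.
apply: (@proj_unique _ _ (a *: s x + s y) _ (a *: c x + c y)) => //.
- by apply: subspace_sum_R_linear => //; apply: ltnW.
- by apply: subspaceP; [apply: subspace_R|apply: proj_range..].
- by apply: subspaceP; [apply: subspace_Rc|apply: sub_proj_range..].
- rewrite {1}(decomp x) {1}(decomp y) !scalerDr.
  by rewrite [LHS]addrACA [X in X + _]addrACA.
Qed.

End Projections.

(** * Inverse of a linear map on a subspace *)

Section RightInverse.
Context {K : fieldType} {U V : lmodType K} (A : set U) (f : U -> V).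
Hypothesis subA : subspace A.
Hypothesis lin_f : linear f.
Let g := 'pinv_(fun=> 0) A f.

Lemma pinv_range y : (f @` A) y -> A (g y).
Proof.
move=> fAy; apply: (@surjpinv_image_sub _ _ (fun=> 0) A (f @` A) f).
  by move=> ?.
by exists y.
Qed.

Lemma pinv_cancel y : (f @` A) y -> f (g y) = y.
Proof. by move=> fAy; apply/pinvK/mem_set. Qed.

(** Both sides lie in [A] and have the same image under [f], which is injective there; the
    membership hypotheses keep [g] away from its default value 0. *)
Lemma pinv_linear (a : K) y z :
  (forall x, A x -> f x = 0 -> x = 0) ->
  (f @` A) y -> (f @` A) z -> g (a *: y + z) = a *: g y + g z.
Proof.
move=> inj_f Ay Az.
have Ag : A (a *: g y + g z) by apply: subspaceP => //; apply: pinv_range.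
have Ayz : (f @` A) (a *: y + z).
  by exists (a *: g y + g z) => //; rewrite lin_f !pinv_cancel.
apply/eqP; rewrite -subr_eq0 addrC -scaleN1r; apply/eqP/inj_f.
  by apply: subspaceP => //; apply: pinv_range.
have [h fE] := linear_packed lin_f.
by rewrite scaleN1r; move: (pinv_cancel Ayz) (pinv_cancel Ay) (pinv_cancel Az);
  rewrite fE linearD linearN linearP /= => -> -> ->; rewrite addNr.
Qed.

End RightInverse.

(** * Kernels, ranges and linearity in the recursion *)

Section RecursionFacts.
Context {K : fieldType} {B Bbar : lmodType K} {L : nat -> {linear B -> Bbar}}.
Context {m : nat} {N Nc : nat -> set B} {R Rc : nat -> set Bbar}.
Context {Sbar S : nat -> B -> Bbar} {E M : nat -> nat -> B -> B}.
Hypothesis hrec : recursion L m N Nc R Rc Sbar S E M.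

Let Rc0 := rec_Rc0 hrec.
Let sumRc := rec_Rc hrec.

Lemma recursion_S j x : (1 <= j <= m)%N ->
  S j x = Sbar j x - \sum_(1 <= i < j) Defs.proj R Rc i (Sbar j x).
Proof.
case: j => [//|[|j]] hj; last exact: (rec_S hrec).
by rewrite big_geq // subr0 (rec_S1 hrec) (rec_Sbar1 hrec).
Qed.

Lemma recursion_Ejj j : (1 <= j <= m)%N -> E j j =1 id.
Proof.
by case: j => [//|[|j]] hj; [apply: (rec_E11 hrec)|apply: (rec_Ejj hrec)].
Qed.

Lemma recursion_M1 j : (1 <= j <= m)%N -> M 1%N j =1 E 1%N j.
Proof.
case: j => [//|[|j]] hj x; last exact: (rec_M1 hrec).
by rewrite (rec_M11 hrec) (rec_E11 hrec).
Qed.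

Lemma recursion_Mjj j : (1 <= j <= m)%N -> M j j =1 id.
Proof.
elim: j => [//|[|j] IH] hj x; first exact: (rec_M11 hrec).
rewrite (rec_M hrec) ?leqnn // big_nat1 (rec_Ejj hrec) //= IH //.
by rewrite /= ltnW.
Qed.

(** Subtracting the components in R_1, ..., R_(j-1) leaves a vector of R^c_(j-1). *)
Lemma S_range j x : (1 <= j <= m)%N -> Rc j.-1 (S j x).
Proof.
case: j => // j hj; rewrite recursion_S //.
by apply: (sub_proj_range Rc0 sumRc); rewrite ltnW.
Qed.

Lemma S_ker j x : (1 <= j <= m)%N -> N j x -> S j x = 0.
Proof. by move=> hj; rewrite (rec_N hrec hj) => -[]. Qed.

Lemma subspace_N j : (j <= m)%N -> subspace (N j).
Proof.
case: j => [_|j hj]; last by case: (rec_Nc hrec (j := j.+1) hj).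
by rewrite (rec_N0 hrec); split=> [|a x y _ _]; apply/mem_set.
Qed.

Lemma N_antitone i j x : (i <= j <= m)%N -> N j x -> N i x.
Proof.
elim: j => [|j IH] /andP[ij jm]; first by move: ij; rewrite leqn0 => /eqP->.
move: ij; rewrite leq_eqVlt => /predU1P[->//|ij].
rewrite (rec_N hrec (j := j.+1)) // => -[Njx _].
by apply: IH => //; rewrite -ltnS ij ltnW.
Qed.

Lemma Nc_sub_N j x : (1 <= j <= m)%N -> Nc j x -> N j.-1 x.
Proof.
move=> hj Ncx; have [_ sN -> _] := rec_Nc hrec hj.
by exists x => //; exists 0; [apply: subspace0|rewrite addr0].
Qed.

(** N_(j-1) = N^c_j + N_j, and S_j vanishes on N_j. *)
Lemma S_image_Nc j : (1 <= j <= m)%N -> linear (S j) -> S j @` Nc j = R j.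
Proof.
move=> hj /linear_packed[g Sg].
rewrite (rec_R hrec hj); apply/seteqP; split=> y [x hx <-].
  by exists x => //; apply: Nc_sub_N.
have [_ _ def_N _] := rec_Nc hrec hj.
move: hx; rewrite def_N => -[u hu [v hv <-]].
exists u => //; rewrite Sg linearD /= -!Sg.
by rewrite (S_ker hj hv) addr0.
Qed.

(** A kernel vector in N^c_j belongs to N_(j-1), hence to N_j, which meets N^c_j only in 0. *)
Lemma S_inj_Nc j x : (1 <= j <= m)%N -> Nc j x -> S j x = 0 -> x = 0.
Proof.
move=> hj Ncx Sx0; have [_ _ _ cap0] := rec_Nc hrec hj.
suff : [set 0] x by [].
rewrite -cap0; split=> //; rewrite (rec_N hrec hj); split=> //.
exact: Nc_sub_N.
Qed.

Lemma Sinv_proj_linear i : (1 <= i <= m)%N -> linear (S i) ->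
  linear (fun x => 'pinv_(fun=> 0) (Nc i) (S i) (Defs.proj R Rc i x)).
Proof.
move=> hi lS a x y; have [sNc _ _ _] := rec_Nc hrec hi.
rewrite (proj_linear Rc0 sumRc hi) pinv_linear //.
- by move=> z; apply: S_inj_Nc.
- by rewrite S_image_Nc //; apply: (proj_range Rc0 sumRc).
- by rewrite S_image_Nc //; apply: (proj_range Rc0 sumRc).
Qed.

(** Strong induction follows the order of construction: Sbar_j from the M_(i,j-1), then S_j, then
    E_(i,j), and finally M_(i,j) from the M_(i-1,nu-1) with nu <= j. *)
Lemma recursion_linear j : (1 <= j <= m)%N ->
  [/\ linear (Sbar j), linear (S j),
      forall i, (1 <= i <= j)%N -> linear (E i j)
    & forall i, (1 <= i <= j)%N -> linear (M i j)].
Proof.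
elim/ltn_ind: j => j IH hj.
have lSbar : linear (Sbar j).
  case: j hj IH => [//|[|j]] hj IH.
    by apply: (linear_eqfun (rec_Sbar1 hrec)); apply: linearP.
  apply: (linear_eqfun (rec_Sbar hrec (j := j.+2) hj)).
  apply: linear_bigsum => i hi; apply: linear_comp; first exact: linearP.
  by have [_ _ _] := IH j.+1 (ltnSn _) (ltnW hj); apply.
have lS : linear (S j).
  apply: (linear_eqfun (fun x => recursion_S x hj)).
  apply: linear_sub => //; apply: linear_bigsum => i /andP[i1 ij].
  apply: linear_comp => //; apply: (proj_linear Rc0 sumRc).
  by lia.
have lSbarS i : (1 <= i <= j)%N -> linear (Sbar i) /\ linear (S i).
  move=> /andP[i1]; rewrite leq_eqVlt => /predU1P[->//|ij].
  have [] // := IH i ij.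
  by lia.
have lE i : (1 <= i <= j)%N -> linear (E i j).
  (* Induction on j - i, since E_(i,j) is built from the E_(nu,j) with nu > i. *)
  have [d] := ubnP (j - i)%N; elim: d i => // d IHd i le_d /andP[i1].
  rewrite leq_eqVlt => /predU1P[->|ij].
    by apply: (linear_eqfun (recursion_Ejj hj)) => a x y.
  have hj2 : (2 <= j <= m)%N.
    by lia.
  have hi : (1 <= i < j)%N by rewrite i1.
  apply: (linear_eqfun (rec_E hrec hj2 hi)); apply: linear_oppr.
  apply: (@linear_comp _ _ _ _
    (fun x => 'pinv_(fun=> 0) (Nc i) (S i) (Defs.proj R Rc i x))).
    apply: Sinv_proj_linear; last by case: (lSbarS i) => //; rewrite i1 ltnW.
    by lia.
  apply: linear_bigsum => nu /andP[inu nuj].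
  have hnu : (1 <= nu <= j)%N by lia.
  apply: linear_comp; first by case: (lSbarS nu).
  by apply: IHd => //; lia.
split=> // -[//|[|i]] hi.
  by apply: (linear_eqfun (recursion_M1 hj)); apply: lE.
have hj2 : (2 <= j <= m)%N.
  by lia.
apply: (linear_eqfun (rec_M hrec hj2 (i := i.+2) hi)).
apply: linear_bigsum => -[//|nu] /andP[inu nuj] /=.
apply: linear_comp; last by apply: lE; lia.
have nuj' : (nu < j)%N by lia.
by have [|_ _ _] := IH nu nuj'; [|apply]; lia.
Qed.

(** * Cancellation through E and coefficients of the transformed series *)

Lemma E_range i j x : (1 <= i < j)%N -> (j <= m)%N -> Nc i (E i j x).
Proof.
move=> hij jm; have /andP[i1 ij] := hij.
have hi : (1 <= i <= m)%N by lia.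
have [sNc _ _ _] := rec_Nc hrec hi; have [_ lS _ _] := recursion_linear hi.
rewrite (rec_E hrec) ?(leq_ltn_trans i1) //.
apply: subspaceN => //; apply: pinv_range.
by rewrite S_image_Nc //; apply: (proj_range Rc0 sumRc).
Qed.

Lemma S_E i j x : (1 <= i < j)%N -> (j <= m)%N ->
  S i (E i j x) =
  - Defs.proj R Rc i (\sum_(i.+1 <= nu < j.+1) Sbar nu (E nu j x)).
Proof.
move=> hij jm; have /andP[i1 ij] := hij.
have hi : (1 <= i <= m)%N by lia.
have [_ lS _ _] := recursion_linear hi.
have [g Sg] := linear_packed lS.
rewrite (rec_E hrec) ?(leq_ltn_trans i1) // {1}Sg linearN /= -Sg.
by rewrite pinv_cancel // S_image_Nc //; apply: (proj_range Rc0 sumRc).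
Qed.

(* Block Gaussian elimination: the R_i-components for i < j cancel. *)
Lemma sum_Sbar_E j x : (1 <= j <= m)%N ->
  \sum_(1 <= nu < j.+1) Sbar nu (E nu j x) = S j x.
Proof.
move=> hj; have /andP[j1 jm] := hj.
pose P i := Defs.proj R Rc i; pose v nu := Sbar nu (E nu j x).
have hle i : (1 <= i < j.+1)%N -> (1 <= i <= m)%N.
  by lia.
have vE nu : (1 <= nu < j.+1)%N ->
    v nu = S nu (E nu j x) + \sum_(1 <= i < nu) P i (v nu).
  by move=> hnu; rewrite recursion_S ?subrK //; apply: hle.
rewrite (eq_big_nat _ _ vE) big_split /= big_nat_recr //= recursion_Ejj //.
suff -> : \sum_(1 <= nu < j.+1) \sum_(1 <= i < nu) P i (v nu) =
          - \sum_(1 <= i < j) S i (E i j x) by rewrite addrAC subrr add0r.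
(* The term nu = 1 is an empty sum; setting nu = l + 1 turns i < nu into i <= l. For fixed i, the
   sum over l is then the one whose R_i-component S_i E_(i,j) negates. *)
rewrite big_ltn // [X in X + _]big_geq // add0r big_add1 /=.
rewrite -(exchange_big_triangle 1 j (fun i l => P i (v l.+1))) -sumrN.
apply: eq_big_nat => i hi; rewrite S_E // opprK.
have hi' : (1 <= i <= m)%N.
  by lia.
have [p pE] := linear_packed (proj_linear Rc0 sumRc hi').
by rewrite /P pE linear_sum big_add1.
Qed.

(* The coefficient depends on [d] only formally: raising [d] by one expands
   M through E and leaves, besides [S n.+1 x], terms [S l.+1] applied to
   N^c_(l+d+2), which is contained in N_(l+1). *)
Lemma coef_transformed d n x : (0 < d)%N -> (n + d <= m)%N ->
  \sum_(0 <= i < n.+1) L i (M (d + i) (n + d) x) = S n.+1 x.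
Proof.
case: d => // d _; elim: d n x => [|d IH] n x.
  (* Base case: expanding M_(i+1,n+1) and putting nu = l + 1, the inner sum over i >= 1 is
     Sbar_(l+1) by definition; i = 0 gives the term Sbar_1 E_(1,n+1). *)
  rewrite addn1 => nm; rewrite -sum_Sbar_E //.
  rewrite big_ltn // [RHS]big_ltn // addn0 recursion_M1 // (rec_Sbar1 hrec).
  congr (_ + _); rewrite [RHS]big_add1 /=.
  transitivity (\sum_(1 <= i < n.+1) \sum_(i <= l < n.+1)
                  L i (M i l (E l.+1 n.+1 x))).
    apply: eq_big_nat => i /andP[i1 iln].
    rewrite add1n (rec_M hrec) //; try by lia.
    by rewrite big_add1 linear_sum.
  rewrite exchange_big_triangle; apply: eq_big_nat => l /andP[l1 ln].
  by rewrite (rec_Sbar hrec) //; lia.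
rewrite addnS => nm.
transitivity (\sum_(0 <= i < n.+1) \sum_(i <= l < n.+1)
                L i (M (d.+1 + i) (l + d.+1) (E (l + d.+2) (n + d.+1).+1 x))).
  apply: eq_big_nat => i /andP[_ iln].
  rewrite (rec_M hrec); try by lia.
  rewrite linear_sum -[in LHS](addnC i) big_addn.
  rewrite (_ : ((n + d.+1).+2 - d.+2 = n.+1)%N); last by lia.
  apply: eq_big_nat => l _; congr (L i (M _ _ _)); lia.
rewrite exchange_big_triangle.
(* With nu = l + d + 2, the inner sum over i is the coefficient of index l from the induction
   hypothesis, evaluated at a value of E. *)
rewrite (@eq_big_nat _ _ _ _ _ _
  (fun l => S l.+1 (E (l + d.+2) (n + d.+1).+1 x))); last first.
  by move=> l /andP[_ ln]; apply: IH; lia.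
rewrite big_nat_recr //= !addnS recursion_Ejj; last by lia.
rewrite big_nat big1 ?add0r // => l /andP[_ ln].
apply: S_ker; first by lia.
apply: (@N_antitone _ (l + d.+2).-1); first by lia.
by apply: Nc_sub_N; [lia|apply: E_range; lia].
Qed.

End RecursionFacts.

Theorem theorem1 (F : realType) (K : fieldType) (hK : real_or_complex F K)
    (B Bbar : lmodType K) (L : nat -> {linear B -> Bbar})
    (hL : exists i x, L i x != 0)
    (k : nat)
    (N Nc : nat -> set B) (R Rc : nat -> set Bbar)
    (Sbar S : nat -> B -> Bbar) (E M : nat -> nat -> B -> B)
    (hrec : recursion L k.+1 N Nc R Rc Sbar S E M) :
  [/\ forall n, linear (transformation M k n),
      forall i, (1 <= i <= k.+1)%N -> linear (S i),
      exists Q : nat -> {linear B -> Bbar}, forall n x,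
        cauchy_prod (fun i => L i) (transformation M k) n x =
          if (n <= k)%N then S n.+1 x else Q n.+1 x
    & forall i, (1 <= i <= k.+1)%N ->
        [/\ S i @` subspace_sum Nc 0 i `<=` Rc i.-1,
            S i @` Nc i = R i
          & S i @` N i = [set 0]]].
Proof.
have lin := recursion_linear hrec.
have lT n : linear (transformation M k n).
  rewrite /transformation; case: eqP => [_|/eqP n0]; first by move=> a x y.
  case: ifP => [nk|_]; last by move=> a x y; rewrite scaler0 addr0.
  by have [|_ _ _] := lin k.+1; [|apply]; lia.
have lC n : linear (cauchy_prod (fun i => L i) (transformation M k) n).
  by apply: linear_bigsum => i _; apply: linear_comp => //; apply: linearP.
split=> //.
- by move=> i /lin[].
- have [Q QE] := choice (fun n => linear_packed (lC n)).
  (* The remainder Q_(n+1) is the coefficient of eps^n, hence the shift of index. *)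
  exists (fun n => Q n.-1) => n x; case: ifP => [nk|_]; last by rewrite QE.
  (* The choice d = k + 1 - n, positive as n <= k, makes the second index of M equal to k + 1 and
     M_(d+i,k+1) the coefficient of eps^(n-i) in p_k. *)
  rewrite -(coef_transformed hrec (d := k.+1 - n)); try by lia.
  apply: eq_big_nat => i /andP[_ iln]; congr (L i _).
  rewrite (_ : (n + (k.+1 - n) = k.+1)%N); last by lia.
  (* For i = n the coefficient of p_k is I_B, which agrees with M_(k+1,k+1). *)
  rewrite /transformation; case: eqP => [ni0|_].
    rewrite (_ : (k.+1 - n + i = k.+1)%N); last by lia.
    by rewrite (recursion_Mjj hrec) //=.
  by rewrite ifT; [congr (M _ _ x)|]; lia.
- move=> i hi; have [_ lS _ _] := lin _ hi; split.
  + by move=> _ [x _ <-]; apply: (S_range hrec).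
  + exact: (S_image_Nc hrec).
  + apply/seteqP; split=> [_ [x Nx <-]|_ ->].
      exact: (S_ker hrec hi).
    exists 0; last exact: linear_at0.
    by apply: subspace0; apply: (subspace_N hrec); lia.
Qed.
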